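(* Let $R$ be a ring, $S$ a multiplicatively closed subset of $R$, $M$ an $R$-module and $N$ a proper submodule of $M$. Then the following statements hold: (1) If $N$ is a gsdf-absorbing submodule of $M$ and $S^{-1}N\neq S^{-1}M$, then $S^{-1}N$ is a gsdf-absorbing submodule of the $S^{-1}R$-module $S^{-1}M$. (2) If $S^{-1}N$ is a gsdf-absorbing submodule of the $S^{-1}R$-module $S^{-1}M$ and $N$ is $S$-saturated, then $N$ is a gsdf-absorbing submodule of $M$.
   Context: All rings are commutative with identity $1\neq 0$ and all modules are unital. Let $R$ be a ring and $M$ an $R$-module. A proper submodule $N$ of $M$ is called a generalized square-difference factor absorbing submodule (gsdf-absorbing submodule) if for all $u,v\in R$ and $x\in M$, the condition $(u^{2}-v^{2})x\in N$ implies that $(u-v)x\in N$ or $(u+v)^{k}x\in N$ for some integer $k\geq 1$. For a multiplicatively closed subset $S$ of $R$, a proper submodule $N$ of $M$ is called $S$-saturated if for all $s\in S$ and $x\in M$, $sx\in N$ implies $x\in N$. *)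

(* Defs.v *)
From HB Require Import structures.
From mathcomp Require Import all_boot all_algebra.
From mathcomp Require Import boolp ring.

Set Implicit Arguments.
Unset Strict Implicit.
Unset Printing Implicit Defensive.

Import GRing.Theory.
Local Open Scope ring_scope.
Local Open Scope quotient_scope.

(* Subsets are boolean predicates, which loses nothing classically; elements
   of [mulrClosed R] contain 1.  Localizing at an S containing 0 gives the zero
   ring, whence [comPzRingType]. *)

Section Submodules.
Variables (R : comPzRingType) (M : lmodType R).

Definition proper_submod (N : submodClosed M) : Prop := ~ (N =i predT).

Definition gsdf_absorbing (N : submodClosed M) : Prop :=
  proper_submod N /\
  forall (u v : R) (x : M),
    (u ^+ 2 - v ^+ 2) *: x \in N ->
    (u - v) *: x \in N \/
    exists k : nat, (1 <= k)%N /\ (u + v) ^+ k *: x \in N.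

Definition saturated (S : mulrClosed R) (N : submodClosed M) : Prop :=
  proper_submod N /\
  forall (s : R) (x : M), s \in S -> s *: x \in N -> x \in N.

End Submodules.

(* Proves an equality of sums of scaled vectors termwise, up to [ring] on the
   coefficients. *)
Local Ltac scale_termwise :=
  rewrite /= ?(scalerDr, scalerN, scalerA);
  repeat (congr (_ + _) || congr (- _));
  solve [by [] | congr (_ *: _); ring].

Section LocalizationCarrier.
Variables (R : comPzRingType) (S : mulrClosed R) (M : lmodType R).

Definition denom := {s : R | s \in S}.

Definition denom1 : denom := exist _ 1 (rpred1 S).

Lemma denomM_subproof (s t : denom) : sval s * sval t \in S.
Proof. by rewrite rpredM // (svalP s, svalP t). Qed.

Definition denomM (s t : denom) : denom :=
  exist _ (sval s * sval t) (denomM_subproof s t).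

Definition loc_eqv (a b : M * denom) : bool :=
  `[< exists2 u, u \in S & u *: (sval b.2 *: a.1 - sval a.2 *: b.1) = 0 >].

Lemma loc_eqv_refl : reflexive loc_eqv.
Proof. by move=> a; apply/asboolP; exists 1; rewrite ?rpred1 // subrr scaler0. Qed.

Lemma loc_eqv_sym : symmetric loc_eqv.
Proof.
have H a b : loc_eqv a b -> loc_eqv b a.
  move=> /asboolP[u uS e]; apply/asboolP; exists u => //.
  by rewrite -opprB scalerN e oppr0.
by move=> a b; apply/idP/idP; apply: H.
Qed.

Lemma scalerB_eq0P (u : R) (x y : M) : u *: (x - y) = 0 <-> u *: x = u *: y.
Proof.
rewrite scalerBr; split => [/eqP|->]; last by rewrite subrr.
by rewrite subr_eq0 => /eqP.
Qed.

Lemma loc_eqv_trans : transitive loc_eqv.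
Proof.
move=> [y t] [x s] [z w] /asboolP[/= u uS /scalerB_eq0P e1].
move=> /asboolP[/= v vS /scalerB_eq0P e2].
apply/asboolP => /=; exists (u * v * sval t).
  by rewrite !rpredM // (svalP t).
apply/scalerB_eq0P.
have -> : (u * v * sval t) *: (sval w *: x)
    = (v * sval w) *: (u *: (sval t *: x)) by scale_termwise.
rewrite e1.
have -> : (v * sval w) *: (u *: (sval s *: y))
    = (u * sval s) *: (v *: (sval w *: y)) by scale_termwise.
by rewrite e2; scale_termwise.
Qed.

Canonical loc_equiv := EquivRel loc_eqv loc_eqv_refl loc_eqv_sym loc_eqv_trans.

Definition locMod : Type := {eq_quot loc_equiv}.
HB.instance Definition _ := Choice.on locMod.
HB.instance Definition _ := EqQuotient.on locMod.

Definition frac (x : M) (s : denom) : locMod := \pi_locMod (x, s).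

Lemma frac_eqP (x y : M) (s t : denom) :
  frac x s = frac y t <->
  exists2 u, u \in S & u *: (sval t *: x) = u *: (sval s *: y).
Proof.
split=> [/eqmodP /asboolP[u uS /scalerB_eq0P e]|[u uS e]]; first by exists u.
by apply/eqmodP/asboolP; exists u => //; apply/scalerB_eq0P.
Qed.

Lemma frac_eqI (x y : M) (s t : denom) :
  sval t *: x = sval s *: y -> frac x s = frac y t.
Proof. by move=> e; apply/frac_eqP; exists 1; rewrite ?rpred1 // e. Qed.

Lemma frac_surj (z : locMod) : exists x s, z = frac x s.
Proof. by exists (repr z).1, (repr z).2; rewrite /frac -surjective_pairing reprK. Qed.

Lemma frac_repr (z : locMod) : frac (repr z).1 (repr z).2 = z.
Proof. by rewrite /frac -surjective_pairing reprK. Qed.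

Definition loc0 : locMod := frac 0 denom1.

Definition locN (z : locMod) : locMod := frac (- (repr z).1) (repr z).2.

Definition locD (z w : locMod) : locMod :=
  frac (sval (repr w).2 *: (repr z).1 + sval (repr z).2 *: (repr w).1)
       (denomM (repr z).2 (repr w).2).

Lemma locN_frac (x : M) (s : denom) : locN (frac x s) = frac (- x) s.
Proof.
have /frac_eqP[u uS e] := frac_repr (frac x s).
by apply/frac_eqP; exists u; rewrite ?scalerN ?e.
Qed.

Lemma locD_frac (x y : M) (s t : denom) :
  locD (frac x s) (frac y t) = frac (sval t *: x + sval s *: y) (denomM s t).
Proof.
rewrite /locD; have := frac_repr (frac x s); have := frac_repr (frac y t).
move: (repr (frac x s)) (repr (frac y t)) => [x' s'] [y' t'] /= /frac_eqP[v vS ey].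
move=> /frac_eqP[u uS ex]; apply/frac_eqP; exists (u * v); first exact: rpredM.
rewrite /= !scalerDr; congr (_ + _).
  have -> : (u * v) *: ((sval s * sval t) *: (sval t' *: x'))
      = (v * sval t * sval t') *: (u *: (sval s *: x')) by scale_termwise.
  by rewrite ex; scale_termwise.
have -> : (u * v) *: ((sval s * sval t) *: (sval s' *: y'))
    = (u * sval s * sval s') *: (v *: (sval t *: y')) by scale_termwise.
by rewrite ey; scale_termwise.
Qed.

Lemma locDA : associative locD.
Proof.
move=> a b c; have [x [s ->]] := frac_surj a; have [y [t ->]] := frac_surj b.
have [z [w ->]] := frac_surj c; rewrite !locD_frac; apply: frac_eqI => /=.
by rewrite !scalerDr addrA; scale_termwise.
Qed.

Lemma locDC : commutative locD.
Proof.
move=> a b; have [x [s ->]] := frac_surj a; have [y [t ->]] := frac_surj b.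
rewrite !locD_frac; apply: frac_eqI => /=.
by rewrite [_ *: y + _]addrC; scale_termwise.
Qed.

Lemma loc0D : left_id loc0 locD.
Proof.
move=> a; have [x [s ->]] := frac_surj a; rewrite locD_frac; apply: frac_eqI.
by rewrite /= scaler0 add0r; scale_termwise.
Qed.

Lemma locND : left_inverse loc0 locN locD.
Proof.
move=> a; have [x [s ->]] := frac_surj a; rewrite locN_frac locD_frac.
by apply: frac_eqI; rewrite /= scalerN addNr !scaler0.
Qed.

HB.instance Definition _ := GRing.isZmodule.Build locMod locDA locDC loc0D locND.

Lemma frac0 : 0 = frac 0 denom1. Proof. by []. Qed.

Lemma fracN (x : M) (s : denom) : - frac x s = frac (- x) s.
Proof. exact: locN_frac. Qed.

Lemma fracD (x y : M) (s t : denom) :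
  frac x s + frac y t = frac (sval t *: x + sval s *: y) (denomM s t).
Proof. exact: locD_frac. Qed.

End LocalizationCarrier.

Arguments denom {R} S.
Arguments denom1 {R} S.
Arguments locMod {R} S M.
Arguments frac {R S M} x s.

(* The localization of R is the additive group of the localization of the
   regular module R^o; the alias carries the ring structure. *)
Definition locRing (R : comPzRingType) (S : mulrClosed R) : Type := @locMod R S R^o.
HB.instance Definition _ (R : comPzRingType) (S : mulrClosed R) :=
  GRing.Zmodule.on (locRing S).

Definition fracR (R : comPzRingType) (S : mulrClosed R) (r : R) (s : denom S) :
  locRing S := @frac R S R^o r s.

Section LocalizationScale.
Variables (R : comPzRingType) (S : mulrClosed R) (M : lmodType R).

Definition locZ (a : locRing S) (z : locMod S M) : locMod S M :=
  let p : R * denom S := repr (a : @locMod R S R^o) in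
  frac (p.1 *: (repr z).1) (denomM p.2 (repr z).2).

Lemma locZ_frac (r : R) (x : M) (s t : denom S) :
  locZ (fracR r s) (frac x t) = frac (r *: x) (denomM s t).
Proof.
rewrite /locZ; have := frac_repr (fracR r s : locMod S R^o).
have := frac_repr (frac x t).
move: (repr (frac x t)) (repr (fracR r s : locMod S R^o)).
move=> [x' t'] [r' s'] /= /frac_eqP[v vS ex].
move=> /frac_eqP[u uS er]; apply/frac_eqP; exists (u * v); first exact: rpredM.
rewrite /=.
have -> : (u * v) *: ((sval s * sval t) *: (r' *: x'))
    = (u * (sval s * r')) *: (v *: (sval t *: x')) by scale_termwise.
have -> : u * (sval s * r') = u * (sval s' * r) by exact: er.
by rewrite ex; scale_termwise.
Qed.

End LocalizationScale.

Section LocalizationRing.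
Variables (R : comPzRingType) (S : mulrClosed R).

Definition locM (a b : locRing S) : locRing S := @locZ R S R^o a b.

Lemma locM_frac (r q : R) (s t : denom S) :
  locM (fracR r s) (fracR q t) = fracR (r * q) (denomM s t).
Proof. exact: locZ_frac. Qed.

Lemma fracR_surj (a : locRing S) : exists r s, a = fracR r s.
Proof. exact: (@frac_surj R S R^o a). Qed.

Lemma fracR_eqI (r q : R) (s t : denom S) :
  sval t * r = sval s * q -> fracR r s = fracR q t.
Proof. by move=> e; apply: (@frac_eqI R S R^o). Qed.

Lemma fracRD (r q : R) (s t : denom S) :
  fracR r s + fracR q t = fracR (sval t * r + sval s * q) (denomM s t).
Proof. exact: (@fracD R S R^o). Qed.

Lemma locMA : associative locM.
Proof.
move=> a b c; have [x [s ->]] := fracR_surj a; have [y [t ->]] := fracR_surj b.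
have [z [w ->]] := fracR_surj c; rewrite !locM_frac; apply: fracR_eqI => /=.
ring.
Qed.

Lemma locMC : commutative locM.
Proof.
move=> a b; have [x [s ->]] := fracR_surj a; have [y [t ->]] := fracR_surj b.
rewrite !locM_frac; apply: fracR_eqI => /=; ring.
Qed.

Lemma loc1M : left_id (fracR 1 (denom1 S)) locM.
Proof.
move=> a; have [x [s ->]] := fracR_surj a.
rewrite locM_frac; apply: fracR_eqI => /=; ring.
Qed.

Lemma locMDl : left_distributive locM +%R.
Proof.
move=> a b c; have [x [s ->]] := fracR_surj a; have [y [t ->]] := fracR_surj b.
have [z [w ->]] := fracR_surj c.
rewrite fracRD !locM_frac fracRD; apply: fracR_eqI => /=; ring.
Qed.

HB.instance Definition _ := GRing.Zmodule_isComPzRing.Build (locRing S)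
  locMA locMC loc1M locMDl.

Lemma fracR1 : 1 = fracR 1 (denom1 S). Proof. by []. Qed.

Lemma fracRM (r q : R) (s t : denom S) :
  fracR r s * fracR q t = fracR (r * q) (denomM s t).
Proof. exact: locM_frac. Qed.

End LocalizationRing.

Section LocalizationModule.
Variables (R : comPzRingType) (S : mulrClosed R) (M : lmodType R).

Lemma locZA (a b : locRing S) (z : locMod S M) :
  locZ a (locZ b z) = locZ (a * b) z.
Proof.
have [r [s ->]] := fracR_surj a; have [q [t ->]] := fracR_surj b.
have [x [w ->]] := frac_surj z.
by rewrite fracRM !locZ_frac; apply: frac_eqI => /=; scale_termwise.
Qed.

Lemma loc1Z : left_id 1 (@locZ R S M).
Proof.
move=> z; have [x [w ->]] := frac_surj z.
by rewrite fracR1 locZ_frac; apply: frac_eqI => /=; scale_termwise.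
Qed.

Lemma locZDr : right_distributive (@locZ R S M) +%R.
Proof.
move=> a z z'; have [r [s ->]] := fracR_surj a; have [x [t ->]] := frac_surj z.
have [y [w ->]] := frac_surj z'.
by rewrite fracD !locZ_frac fracD; apply: frac_eqI => /=; scale_termwise.
Qed.

Lemma locZDl (z : locMod S M) :
  {morph (@locZ R S M)^~ z : a b / a + b}.
Proof.
move=> a b; have [r [s ->]] := fracR_surj a; have [q [t ->]] := fracR_surj b.
have [x [w ->]] := frac_surj z.
rewrite fracRD !locZ_frac fracD; apply: frac_eqI => /=.
by rewrite scalerDl; scale_termwise.
Qed.

HB.instance Definition _ := GRing.Zmodule_isLmodule.Build (locRing S) (locMod S M)
  locZA loc1Z locZDr locZDl.

Lemma fracZ (r : R) (x : M) (s t : denom S) :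
  fracR r s *: frac x t = frac (r *: x) (denomM s t).
Proof. exact: locZ_frac. Qed.

(* Underlying set of the submodule S^-1 N = {x / s | x in N, s in S} of S^-1 M. *)
Definition locSubmod_pred (N : submodClosed M) : {pred locMod S M} :=
  fun z => `[< exists (x : M) (s : denom S), x \in N /\ z = frac x s >].

Lemma locSubmod_predP (N : submodClosed M) (z : locMod S M) :
  reflect (exists (x : M) (s : denom S), x \in N /\ z = frac x s)
          (z \in locSubmod_pred N).
Proof. exact: asboolP. Qed.

Lemma locSubmod_pred_closed (N : submodClosed M) :
  submod_closed (locSubmod_pred N).
Proof.
split; first by apply/locSubmod_predP; exists 0, (denom1 S); rewrite rpred0.
move=> a z z' /locSubmod_predP[x [s [xN ->]]] /locSubmod_predP[y [t [yN ->]]].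
have [r [w ->]] := fracR_surj a; apply/locSubmod_predP.
rewrite fracZ fracD; do 2!eexists; split; last reflexivity.
by rewrite rpredD ?rpredZ.
Qed.

HB.instance Definition _ (N : submodClosed M) :=
  GRing.isSubmodClosed.Build (locRing S) (locMod S M) (locSubmod_pred N)
    (locSubmod_pred_closed N).

Definition locSubmod (N : submodClosed M) : submodClosed (locMod S M) :=
  GRing.SubmodClosed.clone (locRing S) (locMod S M) (locSubmod_pred N) _.

Lemma locSubmodP (N : submodClosed M) (z : locMod S M) :
  reflect (exists (x : M) (s : denom S), x \in N /\ z = frac x s)
          (z \in locSubmod N).
Proof. exact: asboolP. Qed.

End LocalizationModule.

Arguments locSubmod {R} S {M} N.

(* Main.v *)
Require Import Defs.
From mathcomp Require Import all_boot all_algebra.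
From mathcomp Require Import ring.

Set Implicit Arguments.
Unset Strict Implicit.
Unset Printing Implicit Defensive.

Import GRing.Theory.
Local Open Scope ring_scope.
Local Notation frac := Defs.frac.

(** A fraction x/s lies in S^-1 N iff c x lies in N for some c in S, which for
    an S-saturated N means that x lies in N.  For (1), write u = p/w and v = q/w
    over a common denominator and let z = x/r: if (u^2 - v^2) z lies in S^-1 N
    then (p^2 - q^2)(c x) lies in N for some c in S, and the absorbing property
    of N is applied to p, q and c x.  For (2), apply that of S^-1 N to u/1, v/1
    and x/1. *)

(** If x/s = y/t with y in N, then u t x = u s y lies in N for some u in S, so c = u t works.
    Conversely, x/s = (c x)/(c s). *)
Lemma frac_locSubmodP (R : comPzRingType) (S : mulrClosed R) (M : lmodType R)
    (N : submodClosed M) (x : M) (s : denom S) :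
  frac x s \in locSubmod S N <-> exists2 c, c \in S & c *: x \in N.
Proof.
split=> [/locSubmodP[y [t [yN /frac_eqP[u uS e]]]]|[c cS cxN]].
  exists (u * sval t); first by rewrite rpredM // (svalP t).
  by rewrite -scalerA e !rpredZ.
apply/locSubmodP; exists (c *: x), (denomM (exist _ c cS) s); split=> //.
by apply: frac_eqI; rewrite /= scalerA mulrC.
Qed.

Lemma saturated_frac_locSubmod (R : comPzRingType) (S : mulrClosed R)
    (M : lmodType R) (N : submodClosed M) (x : M) (s : denom S) :
  saturated S N -> (frac x s \in locSubmod S N) = (x \in N).
Proof.
move=> [_ satN]; apply/idP/idP => [/frac_locSubmodP[c cS /(satN c x cS)] //|xN].
by apply/frac_locSubmodP; exists 1; rewrite ?rpred1 ?scale1r.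
Qed.

Section FractionArithmetic.
Variables (R : comPzRingType) (S : mulrClosed R).
Implicit Types (r q : R) (s t w : denom S).

Lemma fracRDw r q w : fracR r w + fracR q w = fracR (r + q) w.
Proof. by rewrite fracRD; apply: fracR_eqI => /=; ring. Qed.

Lemma fracRBw r q w : fracR r w - fracR q w = fracR (r - q) w.
Proof.
by rewrite -fracRDw; congr (_ + _); exact: (@fracN R S R^o).
Qed.

(** The denominator can stay unspecified, since whether x/s lies in S^-1 N does not depend on s. *)
Lemma fracRX r s k : exists t, fracR r s ^+ k = fracR (r ^+ k) t.
Proof.
elim: k => [|k [t IHk]]; first by exists (denom1 S).
by exists (denomM s t); rewrite !exprS IHk fracRM.
Qed.

(** Over one denominator, sums and differences act on numerators alone, so a^2 - b^2 becomes (p^2 -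
    q^2)/w^2. *)
Lemma fracR_common_denom (a b : locRing S) :
  exists p q w, a = fracR p w /\ b = fracR q w.
Proof.
have [r [s ->]] := fracR_surj a; have [q [t ->]] := fracR_surj b.
exists (sval t * r), (sval s * q), (denomM s t).
by split; apply: fracR_eqI => /=; ring.
Qed.

End FractionArithmetic.

Lemma gsdf_absorbing_locSubmod (R : comPzRingType) (S : mulrClosed R)
    (M : lmodType R) (N : submodClosed M) :
  gsdf_absorbing N -> proper_submod (locSubmod S N) ->
  gsdf_absorbing (locSubmod S N).
Proof.
move=> [_ absN] properSN; split=> // u v z.
have [p [q [w [-> ->]]]] := fracR_common_denom u v.
have [x [r ->]] := frac_surj z.
rewrite !expr2 !fracRM fracRBw fracRDw fracRBw !fracZ.
move=> /frac_locSubmodP[c cS]; rewrite -!expr2 scalerA mulrC -scalerA.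
move=> /absN[pqN|[k [k_gt0 pqN]]]; [left|right; exists k; split=> //].
  (* The same c witnesses membership in S^-1 N in both alternatives. *)
  by apply/frac_locSubmodP; exists c => //; rewrite scalerA mulrC -scalerA.
have [t ->] := fracRX (p + q) w k; rewrite fracZ.
by apply/frac_locSubmodP; exists c => //; rewrite scalerA mulrC -scalerA.
Qed.

Lemma gsdf_absorbing_of_locSubmod (R : comPzRingType) (S : mulrClosed R)
    (M : lmodType R) (N : submodClosed M) :
  gsdf_absorbing (locSubmod S N) -> saturated S N -> gsdf_absorbing N.
Proof.
(* Properness of N is the first component of [saturated]. *)
move=> [_ absSN] satN; split=> [|u v x uvxN]; first exact: satN.1.
pose d := denom1 S.
have [] := absSN (fracR u d) (fracR v d) (frac x d).
- by rewrite !expr2 !fracRM fracRBw fracZ saturated_frac_locSubmod // -!expr2.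
- by rewrite fracRBw fracZ saturated_frac_locSubmod //; left.
move=> [k [k_gt0]]; have [t e] := fracRX (u + v) d k.
rewrite fracRDw e fracZ saturated_frac_locSubmod // => uvkxN.
by right; exists k.
Qed.

Theorem proposition3p1 (R : comNzRingType) (S : mulrClosed R)
    (M : lmodType R) (N : submodClosed M) (hN : proper_submod N) :
  (gsdf_absorbing N -> proper_submod (locSubmod S N) ->
     gsdf_absorbing (locSubmod S N))
  /\
  (gsdf_absorbing (locSubmod S N) -> saturated S N -> gsdf_absorbing N).
Proof.
split; first exact: gsdf_absorbing_locSubmod.
exact: gsdf_absorbing_of_locSubmod.
Qed.
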